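(* Let $n\geqslant 1$ be an integer, $X=\{1,\ldots,n\}$, let $I=[a,b]$ and $J=[c,d]$ be nontrivial bounded closed real intervals, and consider a function $f\colon J^n\to I$. The following assertions are equivalent. (i) $f$ is a quasi-Sugeno integral. (ii) $f$ is comonotonically maxitive and comonotonically minitive. (iii) $f$ is nondecreasing, and there exists a nondecreasing function $\varphi\colon J\to I$ such that for every $\mathbf{x}\in J^n$ and every $r\in J$, $$f(r\vee\mathbf{x})=\varphi(r)\vee f(\mathbf{x})\qquad\text{and}\qquad f(r\wedge\mathbf{x})=\varphi(r)\wedge f(\mathbf{x}).$$ Moreover, in this case, $\varphi$ in (iii) can be chosen as $\varphi(x)=f(x,\ldots,x)$.
   Context: Notation: $\wedge$ and $\vee$ denote minimum and maximum (componentwise on $n$-tuples). For $r\in J$ and $\mathbf{x}\in J^n$, $r\vee\mathbf{x}$ (resp. $r\wedge\mathbf{x}$) is the $n$-tuple whose $i$th component is $r\vee x_i$ (resp. $r\wedge x_i$). $\mathfrak{S}_X$ is the set of permutations of $X=\{1,\ldots,n\}$. For an interval $K$ and $\sigma\in\mathfrak{S}_X$, $K^n_\sigma=\{\mathbf{x}=(x_1,\ldots,x_n)\in K^n : x_{\sigma(1)}\leqslant\cdots\leqslant x_{\sigma(n)}\}$. For $i\in X$, $S_\sigma^{\uparrow}(i)=\{\sigma(i),\ldots,\sigma(n)\}$. A function $f\colon J^n\to I$ is nondecreasing if it is nondecreasing with respect to the componentwise order. Quasi-Sugeno integral: an $I$-valued capacity on $X$ is an order-preserving map $\mu\colon 2^X\to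 I$ (that is, $\mu(S)\leqslant\mu(T)$ whenever $S\subseteq T$) with $\mu(\varnothing)=a$ and $\mu(X)=b$. The Sugeno integral with respect to $\mu$ is the (well-defined) function $\mathcal{S}_\mu\colon I^n\to I$ given by $$\mathcal{S}_\mu(\mathbf{x})=\bigvee_{i\in X}\big(x_{\sigma(i)}\wedge\mu(S_\sigma^{\uparrow}(i))\big),\qquad \mathbf{x}\in I^n_\sigma,\ \sigma\in\mathfrak{S}_X.$$ A quasi-Sugeno integral is a function $f\colon J^n\to I$ of the form $f(\mathbf{x})=\mathcal{S}_\mu(\varphi(x_1),\ldots,\varphi(x_n))$ for some $I$-valued capacity $\mu$ on $X$ and some nondecreasing function $\varphi\colon J\to I$. Comonotonic maxitivity and minitivity: two $n$-tuples $\mathbf{x},\mathbf{x}'\in J^n$ are comonotonic if there exists $\sigma\in\mathfrak{S}_X$ such that $\mathbf{x},\mathbf{x}'\in J^n_\sigma$. A function $f\colon J^n\to I$ is comonotonically maxitive (resp. comonotonically minitive) if $f(\mathbf{x}\vee\mathbf{x}')=f(\mathbf{x})\vee f(\mathbf{x}')$ (resp. $f(\mathbf{x}\wedge\mathbf{x}')=f(\mathbf{x})\wedge f(\mathbf{x}')$) for all comonotonic $\mathbf{x},\mathbf{x}'\in J^n$. *)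

(* Defs.v *)
From mathcomp Require Export all_boot all_order all_algebra all_fingroup.
From mathcomp Require Export boolp functions reals.

Set Implicit Arguments.
Unset Strict Implicit.
Unset Printing Implicit Defensive.

Import Order.TTheory GRing.Theory Num.Theory.

Local Open Scope ring_scope.

(* The index set X = {1, ..., n} is rendered as 'I_n, indexed from 0, an
   n-tuple of reals as a function 'I_n -> R, and a function J -> I or J^n -> I
   as a total function on R or R^n of which only the values on J or J^n are
   ever constrained or used.  On n-tuples, <=%O is the library's pointwise
   order on functions, and \max, \min are the componentwise operations. *)

Section SugenoIntegral.
Context (R : realType) (n : nat).
Implicit Types (s : 'S_n) (x y : 'I_n -> R) (mu : {set 'I_n} -> R).
Implicit Types (a b c d : R) (f : ('I_n -> R) -> R) (phi : R -> R).

Definition cube c d x : Prop := forall i, x i \in `[c, d].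

Definition ordered_by s x : bool :=
  [forall i : 'I_n, forall j : 'I_n, (i <= j)%N ==> (x (s i) <= x (s j))].

Definition upset s (i : 'I_n) : {set 'I_n} := [set s j | j : 'I_n & (i <= j)%N].

(* The bounds force all the values of mu to lie in [a, b]. *)
Definition capacity a b mu : Prop :=
  [/\ {homo mu : S T / S \subset T >-> S <= T}, mu set0 = a & mu setT = b].

(* The default value a is the bottom of I = [a, b], hence neutral for the
   maximum of (at least one) elements of I. *)
Definition sugeno_formula a mu s x : R :=
  \big[Num.max/a]_(i < n) Num.min (x (s i)) (mu (upset s i)).

(* A permutation ordering x always exists; by sugenoE below the value does not
   depend on the one that is picked. *)
Definition sugeno a mu x : R :=
  if [pick s : 'S_n | ordered_by s x] is Some s then sugeno_formula a mu s x
  else a.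

Definition nondecreasing_on c d phi : Prop :=
  {in `[c, d] &, {homo phi : r t / r <= t}}.

Definition maps_into c d a b phi : Prop :=
  {homo phi : r / r \in `[c, d] >-> r \in `[a, b]}.

Definition quasi_sugeno a b c d f : Prop :=
  exists mu phi, [/\ capacity a b mu, maps_into c d a b phi,
    nondecreasing_on c d phi &
    forall x, cube c d x -> f x = sugeno a mu (phi \o x)].

Definition comonotonic x y : Prop :=
  exists s, ordered_by s x /\ ordered_by s y.

Definition comonotonically_maxitive c d f : Prop :=
  forall x y, cube c d x -> cube c d y -> comonotonic x y ->
    f (x \max y) = Num.max (f x) (f y).

Definition comonotonically_minitive c d f : Prop :=
  forall x y, cube c d x -> cube c d y -> comonotonic x y ->
    f (x \min y) = Num.min (f x) (f y).

Definition nondecreasing_cube c d f : Prop :=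
  forall x y, cube c d x -> cube c d y -> (x <= y)%O -> f x <= f y.

Definition homogeneous_by c d f phi : Prop :=
  forall x r, cube c d x -> r \in `[c, d] ->
    f (cst r \max x) = Num.max (phi r) (f x) /\
    f (cst r \min x) = Num.min (phi r) (f x).

Lemma sugeno_formula_le a b mu s t x : capacity a b mu ->
  ordered_by s x -> ordered_by t x ->
  sugeno_formula a mu s x <= sugeno_formula a mu t x.
Proof.
move=> [mu_homo _ _] /forallP sx /forallP tx.
apply/bigmax_leP; split=> [|i _]; first exact: bigmax_ge_id.
pose P (j : 'I_n) := t j \in upset s i.
have P0 : P (t^-1 (s i))%g.
  by rewrite /P permKV; apply/imsetP; exists i; rewrite ?inE.
case: (arg_minnP (fun j : 'I_n => val j) P0) => j Pj jmin.
apply: (le_trans _ (le_bigmax _ _ j)).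
rewrite le_min !ge_min; apply/andP; split.
  apply/orP; left; case/imsetP: Pj => k; rewrite inE => ik ->.
  by have /forallP/(_ k)/implyP/(_ ik) := sx i.
apply/orP; right; apply: mu_homo; apply/subsetP => u us.
apply/imsetP; exists (t^-1 u)%g; rewrite ?permKV// inE.
by apply: jmin; rewrite /P permKV.
Qed.

Lemma sugenoE a b mu s x : capacity a b mu -> ordered_by s x ->
  sugeno a mu x = sugeno_formula a mu s x.
Proof.
move=> mu_cap sx; rewrite /sugeno; case: pickP => [t tx|/(_ s)]; last first.
  by rewrite sx.
by apply/eqP; rewrite eq_le !(@sugeno_formula_le a b).
Qed.

End SugenoIntegral.

(* Main.v *)
Require Import Defs.
Import Order.TTheory GRing.Theory Num.Theory.
Local Open Scope ring_scope.

Set Implicit Arguments.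
Unset Strict Implicit.
Unset Printing Implicit Defensive.

(** Everything goes through monotonicity on each cone J^n_sigma only.  If [f] is
    nondecreasing on these cones and homogeneous by [phi], then for
    x_sigma(1) <= ... <= x_sigma(n), comparing [x] with the truncated indicators
    x_sigma(i) /\ 1_S(i) from below and x_sigma(i) \/ 1_S(i+1) from above, where
    S(i) = {sigma(i), ..., sigma(n)} and 1_S has values [d] on [S] and [c]
    elsewhere, squeezes f x onto the Sugeno formula with mu S = f 1_S, up to
    resetting mu to [a] on the empty set and to [b] on X.  Both (ii) and (iii)
    provide these two properties.  Monotonicity across cones, which (iii)
    requires, is then inherited from the Sugeno integral. *)

(** * Sorting permutations and comonotonic tuples *)

Section Ordering.
Context (R : realType) (n : nat).
Implicit Types (s : 'S_n) (x y : 'I_n -> R) (S T : {set 'I_n}).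

Lemma ordered_byP s x :
  reflect {homo x \o s : i j / (i <= j)%N >-> i <= j} (ordered_by s x).
Proof.
apply: (iffP forallP) => [sx i j ij | sx i].
  by have /forallP/(_ j)/implyP/(_ ij) := sx i.
by apply/forallP => j; apply/implyP; apply: sx.
Qed.

(** Sorting the list of indices by their [x]-values rearranges it by the required permutation. *)
Lemma ordered_by_exists x : exists s, ordered_by s x.
Proof.
have /tuple_permP[s sE] : perm_eq (sort (relpre x <=%R) (ord_tuple n)) (ord_tuple n).
  by rewrite perm_sort.
exists s; apply/ordered_byP => i j ij /=.
have le_total' : total (relpre x <=%R) by move=> k l; apply: le_total.
have le_trans' : transitive (relpre x <=%R) by move=> k l m; apply: le_trans.
have le_refl' : reflexive (relpre x <=%R) by move=> k; apply: lexx.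
have := sort_sorted le_total' (ord_tuple n); rewrite sE => srt.
have := sorted_leq_nth le_trans' le_refl' i srt.
move=> /(_ i j); rewrite !inE !size_tuple => /(_ (ltn_ord i) (ltn_ord j) ij).
by rewrite !nth_mktuple !tnth_ord_tuple.
Qed.

Lemma ordered_by_homo s x y : {homo id : i j / x i <= x j >-> y i <= y j} ->
  ordered_by s x -> ordered_by s y.
Proof.
by move=> xy /ordered_byP sx; apply/ordered_byP => i j ij; apply/xy/sx.
Qed.

Lemma ordered_by_max s x y : ordered_by s x -> ordered_by s y ->
  ordered_by s (x \max y).
Proof.
move=> /ordered_byP sx /ordered_byP sy; apply/ordered_byP => i j ij.
by rewrite /= le_max2//; [apply: sx|apply: sy].
Qed.

Lemma ordered_by_min s x y : ordered_by s x -> ordered_by s y ->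
  ordered_by s (x \min y).
Proof.
move=> /ordered_byP sx /ordered_byP sy; apply/ordered_byP => i j ij.
by rewrite /= le_min2//; [apply: sx|apply: sy].
Qed.

Lemma ordered_by_cst s (r : R) : ordered_by s (cst r).
Proof. by apply/ordered_byP => i j _ /=. Qed.

Lemma comonotonic_cst (r : R) x : comonotonic (cst r) x.
Proof. by have [s sx] := ordered_by_exists x; exists s; rewrite ordered_by_cst. Qed.

Lemma mem_upset s (i j : 'I_n) : (s j \in upset s i) = (i <= j)%N.
Proof. by rewrite mem_imset ?inE//; apply: perm_inj. Qed.

End Ordering.

(** * Two-valued tuples attached to subsets *)

Section Indicator.
Context (R : realType) (n : nat) (c d : R).
Hypothesis c_le_d : c <= d.
Implicit Types (s : 'S_n) (S T : {set 'I_n}).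

Definition indicator S (i : 'I_n) : R := if i \in S then d else c.

Lemma indicator_cube S : cube c d (indicator S).
Proof. by move=> i; rewrite /indicator; case: ifP; rewrite in_itv /= lexx c_le_d. Qed.

Lemma ordered_by_indicator s i : ordered_by s (indicator (upset s i)).
Proof.
apply/ordered_byP => j k jk; rewrite /= /indicator !mem_upset.
by case: ifP => [ij|_]; [rewrite (leq_trans ij jk)|case: ifP].
Qed.

Lemma indicator_subset S T : S \subset T -> (indicator S <= indicator T)%O.
Proof.
move=> /subsetP ST; apply/lefP => i; rewrite /indicator.
by case: ifP => [/ST ->//|_]; case: ifP.
Qed.

Lemma comonotonic_indicator S T : S \subset T ->
  comonotonic (indicator S) (indicator T).
Proof.
move=> /subsetP ST.
(* As [S \subset T], this tuple is 2 on [S], 1 on the rest of [T] and 0 elsewhere, so both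
   indicators are nondecreasing functions of it and any permutation sorting it sorts them. *)
pose x i : R := ((i \in S) + (i \in T))%:R.
have [s sx] := ordered_by_exists x; exists s.
split; apply: ordered_by_homo sx => i j; rewrite /x ler_nat /indicator;
  move: (introT implyP (ST i)) (introT implyP (ST j)); case: (i \in S); case: (j \in S);
  by case: (i \in T); case: (j \in T).
Qed.

End Indicator.

(** * Monotonicity, comonotonic maxitivity and minitivity of the Sugeno integral *)

Section SugenoProperties.
Context (R : realType) (n : nat) (a b : R) (mu : {set 'I_n} -> R).
Hypothesis mu_cap : capacity a b mu.
Implicit Types (s : 'S_n) (x y : 'I_n -> R).

Lemma sugeno_homo x y : (x <= y)%O -> sugeno a mu x <= sugeno a mu y.
Proof.
have [mu_homo _ _] := mu_cap; move=> /lefP xy.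
have [s sx] := ordered_by_exists x; have [t ty] := ordered_by_exists y.
rewrite (sugenoE mu_cap sx) (sugenoE mu_cap ty).
apply/bigmax_leP; split=> [|i _]; first exact: bigmax_ge_id.
(* The tuples may be sorted by different permutations. The term at [i] is dominated by the one at
   the first [j] in the order of [t] with [t j] in [upset s i]: then
   [x (s i) <= x (t j) <= y (t j)], and [upset s i] is contained in [upset t j]. *)
pose P (j : 'I_n) := t j \in upset s i.
have P0 : P (t^-1 (s i))%g by rewrite /P permKV mem_upset.
case: (arg_minnP (fun j : 'I_n => val j) P0) => j Pj jmin.
apply: (le_trans _ (le_bigmax _ _ j)); apply: le_min2.
  apply: le_trans (xy _); case/imsetP: Pj => k; rewrite inE => ik ->.
  by have /ordered_byP := sx; apply.
apply: mu_homo; apply/subsetP => u us.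
by rewrite -(permKV t u) mem_upset jmin// /P permKV.
Qed.

(** One permutation sorts both tuples and their maximum, so distributivity applies term by term. *)
Lemma sugeno_max x y : comonotonic x y ->
  sugeno a mu (x \max y) = Num.max (sugeno a mu x) (sugeno a mu y).
Proof.
case=> s [sx sy]; rewrite (sugenoE mu_cap (ordered_by_max sx sy)).
rewrite (sugenoE mu_cap sx) (sugenoE mu_cap sy) -bigmax_split.
by apply: eq_bigr => i _; rewrite min_maxl.
Qed.

Lemma sugeno_min x y : comonotonic x y ->
  sugeno a mu (x \min y) = Num.min (sugeno a mu x) (sugeno a mu y).
Proof.
move=> [s [sx sy]]; apply/eqP; rewrite eq_le; apply/andP; split.
  rewrite le_min; apply/andP; split; apply: sugeno_homo; apply/lefP => i /=.
  - by rewrite ge_min lexx.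
  - by rewrite ge_min lexx orbT.
rewrite (sugenoE mu_cap (ordered_by_min sx sy)).
rewrite (sugenoE mu_cap sx) (sugenoE mu_cap sy); set z := (X in _ <= X).
(* This rules out the default value [a]: a maximum exceeding [z] must do so through one of its
   terms. *)
have az : (z < a) = false by apply/negbTE; rewrite -leNgt; apply: bigmax_ge_id.
have zE k : z < x (s k) -> z < y (s k) -> z < mu (upset s k) -> False.
  move=> zx zy zmu.
  have := le_bigmax a (fun i => Num.min ((x \min y) (s i)) (mu (upset s i))) k.
  by rewrite -/(sugeno_formula a mu s _) -/z leNgt /= !lt_min zx zy zmu.
have /ordered_byP xs := sx; have /ordered_byP ys := sy.
rewrite leNgt lt_min; apply/negP => /andP[].
case/bigmax_gtP => [|[i _ zi]]; first by rewrite az.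
case/bigmax_gtP => [|[j _ zj]]; first by rewrite az.
(* The later of the two indices witnesses all three bounds. *)
move: zi zj; rewrite !lt_min => /andP[zxi zmi] /andP[zyj zmj].
have [ij|/ltnW ji] := leqP i j.
- exact: (zE j (lt_le_trans zxi (xs _ _ ij))).
- exact: (zE i zxi (lt_le_trans zyj (ys _ _ ji))).
Qed.

End SugenoProperties.

(** * Passing between the three conditions *)

Section Characterization.
Context (R : realType) (n : nat) (a b c d : R) (f : ('I_n -> R) -> R).
Hypotheses (n_gt0 : (0 < n)%N) (c_le_d : c <= d).
Hypothesis f_into : forall x, cube c d x -> f x \in `[a, b].
Implicit Types (s : 'S_n) (x y : 'I_n -> R) (S T : {set 'I_n}) (phi : R -> R).

Definition comonotonically_nondecreasing : Prop :=
  forall x y, cube c d x -> cube c d y -> comonotonic x y ->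
    (x <= y)%O -> f x <= f y.

Lemma cube_cst (r : R) : r \in `[c, d] -> cube c d (cst r : 'I_n -> R).
Proof. by move=> rcd i. Qed.

Lemma cube_max x y : cube c d x -> cube c d y -> cube c d (x \max y).
Proof. by move=> cx cy i /=; case: leP. Qed.

Lemma cube_min x y : cube c d x -> cube c d y -> cube c d (x \min y).
Proof. by move=> cx cy i /=; case: leP. Qed.

(** The two end values are imposed because [f (cst c)] may exceed [a] and [f (cst d)] may fall below
    [b]. *)
Definition indicator_capacity S : R :=
  if S == set0 then a else if S == setT then b else f (indicator c d S).

Lemma indicator_capacity_ge S : S != set0 ->
  f (indicator c d S) <= indicator_capacity S.
Proof.
rewrite /indicator_capacity => /negbTE ->; case: ifP => // _.
by have /f_into := indicator_cube c_le_d S; rewrite in_itv => /andP[].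
Qed.

Lemma indicator_capacityP : comonotonically_nondecreasing ->
  capacity a b indicator_capacity.
Proof.
move=> f_homo.
have ind_ab S : a <= f (indicator c d S) <= b.
  by have /f_into := indicator_cube c_le_d S; rewrite in_itv.
have mu_ab S : a <= indicator_capacity S <= b.
  have /andP[aS Sb] := ind_ab S; have ab := le_trans aS Sb.
  rewrite /indicator_capacity; case: ifP => _; first by rewrite lexx.
  by case: ifP => _; rewrite ?lexx ?ab ?aS.
have TN0 : [set: 'I_n] != set0.
  by apply/set0Pn; exists (Ordinal n_gt0); rewrite inE.
split=> [S T ST||]; last 2 first.
- by rewrite /indicator_capacity eqxx.
- by rewrite /indicator_capacity (negbTE TN0) eqxx.
have [->|S0] := eqVneq S set0.
  by rewrite {1}/indicator_capacity eqxx; have /andP[] := mu_ab T.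
have T0 : T != set0 by apply: contraNneq S0 => T0; rewrite -subset0 -T0.
have [TT|TNT] := eqVneq T setT.
  rewrite TT {2}/indicator_capacity (negbTE TN0) eqxx.
  by have /andP[] := mu_ab S.
have SNT : S != setT by apply: contraNneq TNT => SE; rewrite -subTset -SE.
rewrite /indicator_capacity (negbTE S0) (negbTE T0) (negbTE SNT) (negbTE TNT).
apply: f_homo; [exact: indicator_cube|exact: indicator_cube| |].
- exact: comonotonic_indicator.
- exact: indicator_subset.
Qed.

Lemma quasi_sugeno_of_homogeneous phi :
  comonotonically_nondecreasing -> maps_into c d a b phi ->
  nondecreasing_on c d phi -> homogeneous_by c d f phi -> quasi_sugeno a b c d f.
Proof.
move=> f_homo phi_into phi_homo f_hom; have mu_cap := indicator_capacityP f_homo.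
exists indicator_capacity, phi; split=> // x cx.
have [s sx] := ordered_by_exists x; have /ordered_byP xs := sx.
have sphi : ordered_by s (phi \o x).
  by apply/ordered_byP => i j ij /=; apply: phi_homo; rewrite ?cx//; apply: xs.
rewrite (sugenoE mu_cap sphi).
have [fxa fxb] : a <= f x /\ f x <= b.
  by have /f_into := cx; rewrite in_itv => /andP.
have ind_cube i := indicator_cube c_le_d (upset s i).
have sind i : ordered_by s (indicator c d (upset s i)).
  exact: ordered_by_indicator.
have cxi i : cube c d (cst (x (s i)) : 'I_n -> R) by apply: cube_cst.
have upN0 i : upset s i != set0.
  by apply/set0Pn; exists (s i); rewrite mem_upset.
apply/eqP; rewrite eq_le; apply/andP; split; last first.
  apply/bigmax_leP; split=> // i _ /=; rewrite {1}/indicator_capacity.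
  rewrite (negbTE (upN0 i)); case: eqP => [upT|_].
    (* Here the capacity was reset to [b], so the bound must come from [phi]: [x (s i)] is the least
       entry, and its maximum with [x] is [x] itself. *)
    rewrite ge_min; apply/orP; left; apply/max_idPr.
    rewrite -(f_hom x (x (s i)) cx (cx _)).1; congr f; apply/funext => j /=.
    apply/max_idPr; rewrite -(permKV s j); apply: xs.
    by rewrite -(mem_upset s) permKV upT inE.
  rewrite -(f_hom _ _ (ind_cube i) (cx _)).2; apply: f_homo => //.
  - exact: cube_min.
  - by exists s; rewrite ordered_by_min// ordered_by_cst.
  apply/lefP => j; rewrite /= ge_min /indicator.
  rewrite -(permKV s j) mem_upset; case: ifPn => [/xs /= -> //|_].
  by have := cx (s ((s^-1)%g j)); rewrite in_itv => /andP[/= -> _]; rewrite orbT.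
pose P (i : 'I_n) := f x <= phi (x (s i)).
have n1 : (n.-1 < n)%N by rewrite prednK.
(* The last index carries the greatest entry, whose minimum with [x] is [x]. *)
have P0 : P (Ordinal n1).
  apply/min_idPr; rewrite -(f_hom x _ cx (cx _)).2; congr f; apply/funext => j.
  apply/min_idPr; rewrite -(permKV s j); apply: xs.
  by rewrite /= -ltnS prednK.
(* At the least index where [phi] reaches [f x], the value [phi] takes one step
   earlier is below [f x], so it is [mu] that must reach [f x]. *)
case: (arg_minnP (fun i : 'I_n => val i) P0) => i Pi imin.
apply: (le_trans _ (le_bigmax _ _ i)); rewrite /= le_min; apply/andP; split=> //.
(* At index 0 there is no earlier step, but the upset is everything and its capacity [b] bounds
   [f x]. *)
have [i0|i_gt0] := posnP i.
  suff -> : upset s i = setT by case: mu_cap => _ _ ->.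
  by apply/setP => j; rewrite -(permKV s j) mem_upset i0 !inE.
have i'n : (i.-1 < n)%N by rewrite (leq_ltn_trans (leq_pred i)).
pose i' := Ordinal i'n.
apply: (le_trans _ (indicator_capacity_ge (upN0 i))).
(* Entries outside [upset s i] sit at position [i'] or before, hence are at most [x (s i')]; the
   others are at most [d]. *)
have : f x <= Num.max (phi (x (s i'))) (f (indicator c d (upset s i))).
  rewrite -(f_hom _ _ (ind_cube i) (cx _)).1; apply: f_homo => //.
  - exact: cube_max.
  - by exists s; rewrite ordered_by_max// ordered_by_cst.
  apply/lefP => j; rewrite /= le_max /indicator.
  rewrite -(permKV s j) mem_upset; case: ifPn => [_|].
    by apply/orP; right; have := cx (s ((s^-1)%g j)); rewrite in_itv => /andP[].
  by rewrite -ltnNge -{1}(prednK i_gt0) ltnS => /(xs _ i') /= ->.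
rewrite le_max => /orP[/imin/=|//].
by rewrite -{1}(prednK i_gt0) ltnn.
Qed.

(** A nondecreasing [phi] commutes with [max] and [min] and preserves comonotonicity, so both
    properties pass from the Sugeno integral to [f]. *)
Lemma quasi_sugeno_comonotonic : quasi_sugeno a b c d f ->
  comonotonically_maxitive c d f /\ comonotonically_minitive c d f.
Proof.
case=> mu [phi [mu_cap _ phi_homo fE]].
have phi_co x y : cube c d x -> cube c d y -> comonotonic x y ->
    comonotonic (phi \o x) (phi \o y).
  move=> cx cy [s [/ordered_byP sx /ordered_byP sy]]; exists s.
  by split; apply/ordered_byP => i j ij /=; apply: phi_homo; rewrite ?cx ?cy//;
    [apply: sx|apply: sy].
split=> x y cx cy xy; rewrite !fE//; try exact: cube_max; try exact: cube_min.
- rewrite -(sugeno_max mu_cap (phi_co _ _ cx cy xy)); congr sugeno.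
  apply/funext => i /=; case: (leP (x i)) => [|/ltW] /phi_homo H.
    by rewrite max_r ?H.
  by rewrite max_l ?H.
- rewrite -(sugeno_min mu_cap (phi_co _ _ cx cy xy)); congr sugeno.
  apply/funext => i /=; case: (leP (x i)) => [|/ltW] /phi_homo H.
    by rewrite min_l ?H.
  by rewrite min_r ?H.
Qed.

Lemma quasi_sugeno_nondecreasing : quasi_sugeno a b c d f ->
  nondecreasing_cube c d f.
Proof.
case=> mu [phi [mu_cap _ phi_homo fE]] x y cx cy /lefP xy; rewrite !fE//.
by apply: (sugeno_homo mu_cap); apply/lefP => i; apply: phi_homo.
Qed.

(** If [x <= y], then [x \max y] is [y], and maxitivity makes [f y] the maximum of [f x] and
    [f y]. *)
Lemma maxitive_nondecreasing : comonotonically_maxitive c d f ->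
  comonotonically_nondecreasing.
Proof.
move=> f_max x y cx cy xy /lefP le_xy; apply/max_idPr; rewrite -f_max//.
by congr f; apply/funext => i; apply/max_idPr.
Qed.

Lemma diagonal_maps_into : maps_into c d a b (fun r => f (cst r)).
Proof. by move=> r rcd; apply/f_into/cube_cst. Qed.

Lemma diagonal_nondecreasing : comonotonically_nondecreasing ->
  nondecreasing_on c d (fun r => f (cst r)).
Proof.
move=> f_homo r t rcd tcd rt; apply: f_homo; try exact: cube_cst.
- exact: comonotonic_cst.
- by apply/lefP.
Qed.

(** A constant tuple is comonotonic with every tuple. *)
Lemma diagonal_homogeneous :
  comonotonically_maxitive c d f -> comonotonically_minitive c d f ->
  homogeneous_by c d f (fun r => f (cst r)).
Proof.
move=> f_max f_min x r cx rcd.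
split; [rewrite f_max//|rewrite f_min//]; exact: comonotonic_cst.
Qed.

End Characterization.

Theorem theorem19 (R : realType) (n : nat) (a b c d : R)
    (f : ('I_n -> R) -> R) :
  (1 <= n)%N -> a < b -> c < d ->
  (forall x, cube c d x -> f x \in `[a, b]) ->
  let i := quasi_sugeno a b c d f in
  let ii := comonotonically_maxitive c d f /\ comonotonically_minitive c d f in
  let iii_by phi := [/\ maps_into c d a b phi, nondecreasing_on c d phi &
                       homogeneous_by c d f phi] in
  let iii := nondecreasing_cube c d f /\ exists phi, iii_by phi in
  [/\ i <-> ii, ii <-> iii & iii -> iii_by (fun r => f (cst r))].
Proof.
move=> n_gt0 _ /ltW c_le_d f_into i ii iii_by iii.
have i_ii : i -> ii by apply: quasi_sugeno_comonotonic.
have ii_diag : ii -> iii_by (fun r => f (cst r)).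
  case=> f_max f_min; split; first exact: diagonal_maps_into.
  - exact/diagonal_nondecreasing/maxitive_nondecreasing.
  - exact: diagonal_homogeneous.
have ii_i : ii -> i.
  move=> h; have [phi_into phi_homo f_hom] := ii_diag h.
  apply: (quasi_sugeno_of_homogeneous n_gt0 c_le_d f_into _ phi_into) => //.
  exact: maxitive_nondecreasing h.1.
have iii_i : iii -> i.
  move=> [f_homo [phi [phi_into phi_homo f_hom]]].
  apply: (quasi_sugeno_of_homogeneous n_gt0 c_le_d f_into _ phi_into) => //.
  by move=> x y cx cy _; apply: f_homo.
have ii_iii : ii -> iii.
  move=> h; split; first exact: quasi_sugeno_nondecreasing (ii_i h).
  by exists (fun r => f (cst r)); apply: ii_diag.
(* The diagonal choice of [phi] is reached from [iii] by passing through [i] to [ii]. *)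
by split; [split|split=> // /iii_i/i_ii|move=> /iii_i/i_ii/ii_diag].
Qed.
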